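(* For $\beta\ge0$ and $h\in\mathbb R$ let $q(\beta,h)\in[0,1]$ be a solution of $$q=\mathbb E\left[\tanh\left(h+\beta\sqrt q\,Z\right)^2\right],\qquad Z\sim N(0,1),$$ and let $\rho(\beta,h):=\beta^2\kappa(q(\beta,h))$. Then: (i) for every $0\le\beta<1$ and every $h\in\mathbb R$, $\rho(\beta,h)<1$; (ii) for every $h\neq0$ there exists $\delta>0$ such that $\rho(\beta,h)<1$ for all $\beta\in(1,1+\delta)$.
   Context: For $q\in[0,1)$, $\kappa(q):=q/\operatorname{arctanh}q$ if $q\ne0$ and $\kappa(0):=1$. The equation for $q$ always has a solution in $[0,1]$, and for finite $\beta,h$ any solution satisfies $q<1$, so $\kappa(q(\beta,h))$ is well defined. *)

(* Defs.v *)
From HB Require Import structures.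
From mathcomp Require Import all_boot all_order all_algebra.
From mathcomp Require Import all_classical all_reals all_analysis.

Set Implicit Arguments.
Unset Strict Implicit.
Unset Printing Implicit Defensive.

Import Order.TTheory GRing.Theory Num.Theory.
Import numFieldNormedType.Exports.

Local Open Scope classical_set_scope.
Local Open Scope ring_scope.

Definition tanh (R : realType) (x : R) : R :=
  (expR x - expR (- x)) / (expR x + expR (- x)).

(* Only meaningful for -1 < x < 1; elsewhere the value is a junk one coming
   from the conventions for [ln] and for division by 0. *)
Definition arctanh (R : realType) (x : R) : R := ln ((1 + x) / (1 - x)) / 2.

(* Only meaningful on [0, 1[. This is enough: a solution q of the fixed-point
   equation below satisfies q < 1, because tanh ^+ 2 < 1 everywhere. *)
Definition kappa (R : realType) (q : R) : R :=
  if q == 0 then 1 else q / arctanh q.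

(* Equality of laws is only required on measurable sets: the values of a
   measure on the other sets are unspecified. *)
Definition standard_normal (d : measure_display) (T : measurableType d)
    (R : realType) (P : probability T R) (Z : {RV P >-> R}) : Prop :=
  forall A : set R, measurable A -> distribution P Z A = normal_prob 0 1 A.

Definition fixed_point (d : measure_display) (T : measurableType d)
    (R : realType) (P : probability T R) (Z : {RV P >-> R})
    (beta h q : R) : Prop :=
  q%:E = ('E_P[(fun t : T => tanh (h + beta * Num.sqrt q * Z t) ^+ 2)%R])%E.

Definition rho (R : realType) (q : R -> R -> R) (beta h : R) : R :=
  beta ^+ 2 * kappa (q beta h).

(* Main.v *)
(** Since arctanh q >= q + q^3 / 3 on [0, 1[, we have
    rho(beta, h) <= beta^2 / (1 + q(beta, h)^2 / 3), which settles beta < 1.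
    For h <> 0, on the event h Z >= 0 the perturbation beta sqrt(q) Z only pushes
    h away from 0, so q(beta, h) >= P(h Z >= 0) tanh(h)^2 > 0. This bound does
    not depend on beta, so the denominator stays away from 1 as beta tends
    to 1. *)
Require Import Defs.
From HB Require Import structures.
From mathcomp Require Import all_boot all_order all_algebra.
From mathcomp Require Import all_classical all_reals all_analysis.
From mathcomp Require Import measurable_realfun ring lra.
Import Order.TTheory GRing.Theory Num.Theory.
Import numFieldNormedType.Exports.
Local Open Scope classical_set_scope.
Local Open Scope ring_scope.

Section Tanh.
Context {R : realType}.
Implicit Types x y : R.

Lemma tanh_denom_gt0 x : 0 < expR x + expR (- x).
Proof. by rewrite addr_gt0 ?expR_gt0. Qed.

Lemma tanh0 : tanh 0 = 0 :> R.
Proof. by rewrite /tanh oppr0 subrr mul0r. Qed.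

Lemma tanhN x : tanh (- x) = - tanh x.
Proof. by rewrite /tanh opprK -mulNr opprB addrC (addrC (expR (- x))) addrC. Qed.

Lemma ler_tanh x y : x <= y -> tanh x <= tanh y.
Proof.
move=> xy.
rewrite /tanh ler_pdivrMr ?tanh_denom_gt0// mulrAC ler_pdivlMr ?tanh_denom_gt0//.
(* After cross-multiplying, the right side minus the left is twice [expR (- x) * expR y - expR x *
   expR (- y)]. *)
have h : expR x * expR (- y) <= expR (- x) * expR y.
  by rewrite -!expRD ler_expR; lra.
nra.
Qed.

Lemma tanh_gt0 x : 0 < x -> 0 < tanh x.
Proof.
move=> x0; rewrite /tanh divr_gt0 ?tanh_denom_gt0// subr_gt0 ltr_expR; lra.
Qed.

Lemma sqr_tanh_norm x : tanh `|x| ^+ 2 = tanh x ^+ 2.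
Proof. by case: (ger0P x) => // _; rewrite tanhN sqrrN. Qed.

Lemma ler_sqr_tanh x y : `|x| <= `|y| -> tanh x ^+ 2 <= tanh y ^+ 2.
Proof.
move=> xy; rewrite -(sqr_tanh_norm x) -(sqr_tanh_norm y).
by rewrite lerXn2r ?nnegrE ?ler_tanh// -[X in X <= _]tanh0 ler_tanh.
Qed.

Lemma sqr_tanh_gt0 x : x != 0 -> 0 < tanh x ^+ 2.
Proof.
by move=> x0; rewrite -sqr_tanh_norm exprn_gt0// tanh_gt0// normr_gt0.
Qed.

Lemma continuous_tanh : continuous (@tanh R).
Proof.
move=> x; rewrite /tanh; apply: cvgM.
  apply: cvgB; first exact: continuous_expR.
  by apply: continuous_comp; [exact: opp_continuous|exact: continuous_expR].
apply: cvgV; first by rewrite gt_eqF ?tanh_denom_gt0.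
apply: cvgD; first exact: continuous_expR.
by apply: continuous_comp; [exact: opp_continuous|exact: continuous_expR].
Qed.

End Tanh.

Section Kappa.
Context {R : realType}.
Implicit Types x q : R.

(** The bound is the Taylor polynomial of degree 3. Twice the difference, [f], vanishes at 0 and has
    derivative 2 t^4 / (1 - t^2) >= 0, so the mean value theorem gives [f x >= 0]. *)
Lemma arctanh_ge x : 0 <= x < 1 -> x + x ^+ 3 / 3 <= arctanh x.
Proof.
move=> /andP[x0 x1]; rewrite /arctanh.
rewrite ln_div ?posrE; [|lra|lra].
pose f (t : R) := ln (1 + t) - ln (1 - t) - 2 * t - 2 / 3 * t ^+ 3.
pose f' (t : R) := (1 + t)^-1 + (1 - t)^-1 - 2 - 2 * t ^+ 2.
have df t : 0 <= t <= x -> is_derive t 1 f (f' t).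
  move=> /andP[t0 tx].
  have d1 : is_derive (1 + t) 1 (@ln R) (1 + t)^-1 by apply: is_derive1_ln; lra.
  have d2 : is_derive (1 - t) 1 (@ln R) (1 - t)^-1 by apply: is_derive1_ln; lra.
  apply: is_derive_eq; rewrite /f' /GRing.scale/=.
  by field; rewrite !lt0r_neq0//; lra.
have [||c] := @MVT_segment R f f' 0 x x0.
- by move=> t; rewrite in_itv/= => /andP[? ?]; apply: df; lra.
- apply: derivable_within_continuous => t; rewrite in_itv/= => /df ?.
  exact: ex_derive.
rewrite in_itv/= => /andP[c0 cx].
suff : 0 <= f' c.
  rewrite /f addr0 !subr0 ln1 expr0n/= => f'c e.
  by have := mulr_ge0 f'c x0; rewrite -e; lra.
have -> : f' c = 2 * c ^+ 4 / ((1 + c) * (1 - c)).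
  by rewrite /f'; field; rewrite !lt0r_neq0//; lra.
by rewrite divr_ge0// ?mulr_ge0 ?exprn_ge0//; lra.
Qed.

(* A junk value: [arctanh 1 = ln (2 / 0) / 2 = 0], and then [1 / 0 = 0]. *)
Lemma kappa1 : kappa 1 = 0 :> R.
Proof.
by rewrite /kappa oner_eq0 /arctanh subrr invr0 mulr0 ln0// mul0r invr0 mulr0.
Qed.

(** For 0 < q < 1, divide q by both sides of [arctanh_ge] and cancel q. The endpoint 1 is covered by
    the junk value, so the bound applies directly to any solution in [0, 1]. *)
Lemma kappa_le q : 0 <= q <= 1 -> kappa q <= (1 + q ^+ 2 / 3)^-1.
Proof.
move=> /andP[q0]; rewrite le_eqVlt => /predU1P[->|q1].
  by rewrite kappa1 invr_ge0; lra.
rewrite /kappa; case: eqVneq => [->|qn0].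
  by rewrite expr0n/= mul0r addr0 invr1.
have qgt0 : 0 < q by rewrite lt0r qn0.
have := @arctanh_ge q; rewrite q0 q1 => /(_ isT) h.
have q2 : 0 < 1 + q ^+ 2 / 3 by nra.
have a0 : 0 < arctanh q by apply: lt_le_trans h; rewrite addr_gt0// divr_gt0// exprn_gt0.
rewrite ler_pdivrMr// mulrC ler_pdivlMr//.
by apply: le_trans h; rewrite mulrDr mulr1 mulrA -exprS.
Qed.

End Kappa.

Section NormalProb.
Context {R : realType}.

(** The density is continuous and positive, so on the compact interval it attains a positive
    minimum; this minimum times b - a bounds the probability from below. *)
Lemma normal_prob_itv_gt0 (m s a b : R) : s != 0 -> a < b ->
  (0 < normal_prob m s `[a, b]%classic)%E.
Proof.
move=> s0 ab.
have [|c _ cmin] := @EVT_min R (normal_pdf m s) a b (ltW ab).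
  by apply: continuous_subspaceT; exact: continuous_normal_pdf.
have c0 : 0 < normal_pdf m s c.
  by rewrite normal_pdfE// mulr_gt0 ?normal_peak_gt0// /normal_fun expR_gt0.
apply: (@lt_le_trans _ _ ((normal_pdf m s c)%:E * lebesgue_measure `[a, b]%classic)%E).
  by rewrite lebesgue_measure_itv/= lte_fin ab -EFinB -EFinM lte_fin mulr_gt0 ?subr_gt0.
rewrite -integral_cst// /normal_prob.
apply: ge0_le_integral => //.
- by move=> x _; rewrite lee_fin ltW.
- by apply/measurable_EFinP/measurable_funTS; exact: measurable_normal_pdf.
Qed.

End NormalProb.

Section FixedPoint.
Context {R : realType} {d : measure_display} {T : measurableType d}.
Context (P : probability T R) (Z : {RV P >-> R}).

Lemma fixed_point_ge (beta h q : R) (A : set R) :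
  measurable A -> (forall x, A x -> 0 <= h * x) -> 0 <= beta ->
  fixed_point Z beta h q ->
  ((tanh h ^+ 2)%:E * distribution P Z A <= q%:E)%E.
Proof.
move=> mA Ah b0 ->.
have mZA : measurable (Z @^-1` A) by rewrite -[_ @^-1` _]setTI; exact: measurable_funP.
have mf : measurable_fun setT
    (EFin \o (fun t => tanh (h + beta * Num.sqrt q * Z t) ^+ 2)).
  apply/measurable_EFinP/measurable_funX.
  apply: measurableT_comp; first exact: continuous_measurable_fun (@continuous_tanh R).
  apply: measurable_funD => //; apply: measurable_funM => //.
rewrite unlock.
apply: (@le_trans _ _ (\int[P]_(t in Z @^-1` A)
    (tanh (h + beta * Num.sqrt q * Z t) ^+ 2)%:E)%E); last first.
  by apply: ge0_subset_integral => // t _; rewrite lee_fin sqr_ge0.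
rewrite -[distribution P Z A]/(P (Z @^-1` A)) -integral_cst//.
apply: ge0_le_integral => //.
- by move=> t _; rewrite lee_fin sqr_ge0.
- exact: measurable_funTS.
move=> t /Ah hZ; rewrite lee_fin ler_sqr_tanh//.
(* Compare squares: (h + c Z)^2 - h^2 = 2 c (h Z) + (c Z)^2, and both terms are nonnegative on the
   event. *)
set c := beta * _; have c0 : 0 <= c by rewrite mulr_ge0 ?sqrtr_ge0.
rewrite -ler_sqr ?nnegrE// !real_normK ?num_real//.
by have := mulr_ge0 c0 hZ; nra.
Qed.

Context (hZ : standard_normal Z).

Lemma fixed_point_lower_bound (h : R) : h != 0 ->
  exists2 q0 : R, 0 < q0 & forall beta q : R, 0 <= beta ->
    fixed_point Z beta h q -> q0 <= q.
Proof.
move=> h0.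
(* A compact piece of the half-line where h x >= 0 suffices, and its normal probability is positive
   by [normal_prob_itv_gt0]. *)
pose A : set R := if 0 < h then `[0, 1]%classic else `[-1, 0]%classic.
have mA : measurable A by rewrite /A; case: ifP.
have hA x : A x -> 0 <= h * x.
  by rewrite /A; case: ltP => hh; rewrite /= in_itv/= => /andP[? ?]; nra.
have PA : (0 < distribution P Z A)%E.
  by rewrite hZ// /A; case: ifP => _; apply: normal_prob_itv_gt0 => //; lra.
have PAfin : (distribution P Z A)%E \is a fin_num by exact: fin_num_measure.
exists (tanh h ^+ 2 * fine (distribution P Z A)).
  by rewrite mulr_gt0 ?sqr_tanh_gt0// fine_gt0// PA ltey_eq PAfin.
move=> beta q b0 /(fixed_point_ge _ _ _ _ mA hA b0).
by rewrite -{1}(fineK PAfin) -EFinM lee_fin.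
Qed.

End FixedPoint.

Theorem mainTheorem2 (R : realType) (d : measure_display)
    (T : measurableType d) (P : probability T R) (Z : {RV P >-> R})
    (hZ : standard_normal Z) (q : R -> R -> R)
    (hq : forall beta h : R, 0 <= beta ->
       0 <= q beta h <= 1 /\ fixed_point Z beta h (q beta h)) :
  (forall beta h : R, 0 <= beta < 1 -> rho q beta h < 1) /\
  (forall h : R, h != 0 ->
     exists2 delta : R, 0 < delta &
       forall beta : R, 1 < beta < 1 + delta -> rho q beta h < 1).
Proof.
have rho_lt1 beta h : 0 <= beta ->
    beta ^+ 2 < 1 + q beta h ^+ 2 / 3 -> rho q beta h < 1.
  move=> b0 bq; have [q01 _] := hq beta h b0.
  have q1 : 0 < 1 + q beta h ^+ 2 / 3 by rewrite (le_lt_trans _ bq)// sqr_ge0.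
  apply: (@le_lt_trans _ _ (beta ^+ 2 / (1 + q beta h ^+ 2 / 3))).
    by rewrite /rho ler_wpM2l ?sqr_ge0 ?kappa_le.
  by rewrite ltr_pdivrMr// mul1r.
split=> [beta h /andP[b0 b1]|h h0].
  by apply: rho_lt1 => //; have := sqr_ge0 (q beta h); nra.
have [q0 q0gt0 hq0] := fixed_point_lower_bound P Z hZ h h0.
(* Any admissible beta would do here; the solution at beta = 0 lies in [0, 1] and is at least
   [q0]. *)
have q0le1 : q0 <= 1.
  have [/andP[_ q1] fp] := hq 0 h (lexx 0).
  exact: le_trans (hq0 _ _ (lexx 0) fp) q1.
(* As [q0 <= 1], this delta is at most 1, hence (1 + delta)^2 <= 1 + 3 delta = 1 + q0^2 / 3, which
   is at most 1 + q^2 / 3. *)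
exists (q0 ^+ 2 / 9); first by rewrite divr_gt0// exprn_gt0.
move=> beta /andP[b1 bd]; have b0 : 0 <= beta by lra.
apply: rho_lt1 => //; have [_ /(hq0 _ _ b0) qq] := hq beta h b0.
have q0q : q0 ^+ 2 <= q beta h ^+ 2 by rewrite lerXn2r ?nnegrE//; lra.
have q02 : q0 ^+ 2 <= 1 by rewrite expr_le1//; lra.
nra.
Qed.
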